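(* Let the inputs $u_0(\mathbf x;\mathbf a)$ and $u_b(\mathbf x,t;\mathbf a)$ satisfy the Lipschitz parameterization described in the context, and let $N$ pairs of input samples be collected, generated by $N$ independent realizations $\mathbf a^1,\dots,\mathbf a^N$ of the random parameter $\mathbf a\sim P^{\mathrm{true}}_{\mathbf a}$. Let $$\rho_{\mathbf a}:=\mathrm{diam}(\mathrm{supp}(P^{\mathrm{true}}_{\mathbf a}))/2$$ (diameter with respect to $\|\cdot\|_\infty$) and let $\bar{\mathbf a}\in\mathbb R^n$ be such that $\|\mathbf a-\bar{\mathbf a}\|_\infty\le\rho_{\mathbf a}$ for all $\mathbf a\in\mathrm{supp}(P^{\mathrm{true}}_{\mathbf a})$. Given a confidence level $1-\beta$, $\beta\in(0,1)$, define $$\mathcal P^0_{\mathbf x}:=\big\{F\in\mathcal{CD}([\alpha_0(\mathbf x),\gamma_0(\mathbf x)])\,\big|\,W_1(\widehat F^N_{u_0(\mathbf x)},F)\le L_0(\mathbf x)\,\epsilon_N(\beta,\rho_{\mathbf a})\big\},\qquad \mathbf x\in\Omega,$$ $$\mathcal P^b_{\mathbf x,t}:=\big\{F\in\mathcal{CD}([\alpha_b(\mathbf x,t),\gamma_b(\mathbf x,t)])\,\big|\,W_1(\widehat F^N_{u_b(\mathbf x,t)},F)\le L_b(\mathbf x,t)\,\epsilon_N(\beta,\rho_{\mathbf a})\big\},\qquad \mathbf x\in\Gamma,\ t\ge0,$$ where $$[\alpha_0(\mathbf x),\gamma_0(\mathbf x)]:=[u_0(\mathbf x;\bar{\mathbf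 a})-\sqrt n\,L_0(\mathbf x)\rho_{\mathbf a},\ u_0(\mathbf x;\bar{\mathbf a})+\sqrt n\,L_0(\mathbf x)\rho_{\mathbf a}],$$ $$[\alpha_b(\mathbf x,t),\gamma_b(\mathbf x,t)]:=[u_b(\mathbf x,t;\bar{\mathbf a})-\sqrt n\,L_b(\mathbf x,t)\rho_{\mathbf a},\ u_b(\mathbf x,t;\bar{\mathbf a})+\sqrt n\,L_b(\mathbf x,t)\rho_{\mathbf a}].$$ Then $$\mathbb P\Big(\big\{F^{\mathrm{true}}_{u_0(\mathbf x)}\in\mathcal P^0_{\mathbf x}\ \forall\mathbf x\in\Omega\big\}\cap\big\{F^{\mathrm{true}}_{u_b(\mathbf x,t)}\in\mathcal P^b_{\mathbf x,t}\ \forall(\mathbf x,t)\in\Gamma\times\mathbb R_{\ge0}\big\}\Big)\ge1-\beta .$$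
   Context: $\Omega\subset\mathbb R^d$ is a spatial domain with (upstream) boundary $\Gamma$. $u_0(\mathbf x;\mathbf a)$ ($\mathbf x\in\Omega$) and $u_b(\mathbf x,t;\mathbf a)$ ($\mathbf x\in\Gamma,t\ge0$) are real-valued initial and boundary data depending on a random parameter $\mathbf a$ with distribution $P^{\mathrm{true}}_{\mathbf a}$ supported on a compact subset of $\mathbb R^n$, and for all $\mathbf a,\mathbf a'\in\mathbb R^n$ (Euclidean norm) $|u_0(\mathbf x;\mathbf a)-u_0(\mathbf x;\mathbf a')|\le L_0(\mathbf x)\|\mathbf a-\mathbf a'\|$ for all $\mathbf x\in\Omega$, and $|u_b(\mathbf x,t;\mathbf a)-u_b(\mathbf x,t;\mathbf a')|\le L_b(\mathbf x,t)\|\mathbf a-\mathbf a'\|$ for all $\mathbf x\in\Gamma$, $t\ge0$, for continuous $L_0:\Omega\to\mathbb R_{\ge0}$, $L_b:\Gamma\times\mathbb R_{\ge0}\to\mathbb R_{\ge0}$. The $i$-th sample pair is $(u_0(\cdot;\mathbf a^i),u_b(\cdot,\cdot;\mathbf a^i))$; $\mathbb P$ refers to the samples. $F^{\mathrm{true}}_{u_0(\mathbf x)}$ and $F^{\mathrm{true}}_{u_b(\mathbf x,t)}$ are the CDFs of $u_0(\mathbf x;\mathbf a)$ and $u_b(\mathbf x,t;\mathbf a)$ for $\mathbf a\sim P^{\mathrm{true}}_{\mathbf a}$. $\widehat F^N_{u_0(\mathbf x)}$ and $\widehat F^N_{u_b(\mathbf x,t)}$ are the CDFs of the empirical distributions $\frac1N\sum_i\delta_{u_0(\mathbf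 x;\mathbf a^i)}$ and $\frac1N\sum_i\delta_{u_b(\mathbf x,t;\mathbf a^i)}$. $\mathcal{CD}(I)$ is the set of CDFs of scalar random variables with distribution supported on the interval $I$. $W_1$ is the 1-Wasserstein distance (Euclidean norm), also written as a distance between CDFs of scalar distributions. $\epsilon_N(\beta,\rho)=\big(\ln(C\beta^{-1})/c\big)^{1/2}\rho N^{-1/2}$ if $n=1$; $\epsilon_N(\beta,\rho)=h^{-1}\big(\ln(C\beta^{-1})/(cN)\big)\rho$ if $n=2$, with $h(x)=x^2/[\ln(2+1/x)]^2$, $x>0$; $\epsilon_N(\beta,\rho)=\big(\ln(C\beta^{-1})/c\big)^{1/n}\rho N^{-1/n}$ if $n\ge3$. Here $C,c>0$ depend only on $n$ and are the constants of the following known concentration result: if $X_1,\dots,X_N$ are i.i.d. in $\mathbb R^n$ with compactly supported law $\mu$, $\rho=\mathrm{diam}(\mathrm{supp}(\mu))/2$ (in $\|\cdot\|_\infty$) and $\widehat\mu^N=\frac1N\sum_i\delta_{X_i}$, then $\mathbb P(W_1(\widehat\mu^N,\mu)\le\epsilon_N(\beta,\rho))\ge1-\beta$. *)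

(* Defs.v *)
From HB Require Import structures.
From mathcomp Require Import all_boot all_order all_algebra.
From mathcomp Require Import all_classical all_reals all_analysis.

Set Implicit Arguments.
Unset Strict Implicit.
Unset Printing Implicit Defensive.

Import Order.TTheory GRing.Theory Num.Theory.
Import numFieldNormedType.Exports.

Local Open Scope classical_set_scope.
Local Open Scope ring_scope.

(* Borel sigma-algebra on R^n = 'rV[R]_n (the topology is that of the max norm
   `|x|, i.e. the usual one). *)
HB.instance Definition _ (R : realType) (n : nat) :=
  @isMeasurable.Build (sigma_display (@open 'rV[R]_n)) 'rV[R]_n
    <<s (@open 'rV[R]_n) >>
    (@sigma_algebra0 _ setT _) (@sigma_algebraC _ _) (@sigma_algebra_bigcup _ setT _).

(* The library norm `|x| on 'rV[R]_n is the max norm; this is the Euclidean one. *)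
Definition enorm (R : realType) (n : nat) (x : 'rV[R]_n) : R :=
  Num.sqrt (\sum_(i < n) x ord0 i ^+ 2).

Definition edist (R : realType) (n : nat) (x y : 'rV[R]_n) : R := enorm (x - y).

Definition rdist (R : realType) (x y : R) : R := `|x - y|.

Definition msupport (R : realType) (n : nat) (mu : set 'rV[R]_n -> \bar R)
    : set 'rV[R]_n :=
  [set x | forall U : set 'rV[R]_n, open U -> U x -> (0 < mu U)%E].

Definition supported_on (R : realType) (T : Type) (mu : set T -> \bar R)
    (A : set T) : Prop := mu (~` A) = 0%E.

Definition compactly_supported (R : realType) (n : nat)
    (mu : set 'rV[R]_n -> \bar R) : Prop :=
  exists K : set 'rV[R]_n, compact K /\ supported_on mu K.

(* Diameter for the max norm. *)
Definition diam (R : realType) (n : nat) (A : set 'rV[R]_n) : R :=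
  sup [set `|x - y| | x in A & y in A].

Definition empirical (R : realType) (d : measure_display)
    (T : measurableType d) (N : nat) (x : 'I_N -> T) : set T -> \bar R :=
  fun A => ((N%:R^-1)%:E * \sum_(i < N) \d_(x i) A)%E.

Definition coupling (R : realType) (d : measure_display)
    (T : measurableType d) (mu nu : set T -> \bar R)
    : set (probability (T * T)%type R) :=
  [set pi | forall A : set T, measurable A ->
     pi (A `*` setT) = mu A /\ pi (setT `*` A) = nu A].

(* 1-Wasserstein distance for the ground distance [dist]. *)
Definition wasserstein1 (R : realType) (d : measure_display)
    (T : measurableType d) (dist : T -> T -> R) (mu nu : set T -> \bar R)
    : \bar R :=
  ereal_inf [set (\int[pi]_z (dist z.1 z.2)%:E)%E | pi in coupling mu nu].

(* As for the library's [cdf], CDFs take values in \bar R; for a random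
   variable X, [cdf X] is convertible to [cdf_of (distribution P X)]. *)
Definition cdf_of (R : realType) (mu : set R -> \bar R) : R -> \bar R :=
  fun y => mu `]-oo, y]%classic.

(* A CDF determines its distribution, so for CDFs F and G the infimum is over
   a singleton. *)
Definition wasserstein1_cdf (R : realType) (F G : R -> \bar R) : \bar R :=
  ereal_inf [set w | exists mu nu : probability R R,
    [/\ cdf_of mu = F, cdf_of nu = G & w = wasserstein1 (@rdist R) mu nu]].

Definition CD (R : realType) (I : set R) : set (R -> \bar R) :=
  [set F | exists (d : measure_display) (T : measurableType d)
      (P : probability T R) (X : {RV P >-> R}),
      supported_on (distribution P X) I /\ F = cdf X].

Definition ambiguity (R : realType) (I : set R) (Fhat : R -> \bar R) (r : R)
    : set (R -> \bar R) :=
  [set F | CD I F /\ (wasserstein1_cdf Fhat F <= r%:E)%E].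

Definition iid (R : realType) (d d' : measure_display) (T : measurableType d)
    (T' : measurableType d') (P : probability T R) (N : nat)
    (X : 'I_N -> {RV P >-> T'}) (mu : set T' -> \bar R) : Prop :=
  (forall (i : 'I_N) (A : set T'), measurable A ->
     distribution P (X i) A = mu A) /\
  (forall B : 'I_N -> set T', (forall i, measurable (B i)) ->
     P (\bigcap_(i in [set: 'I_N]) (X i @^-1` B i)) =
     (\prod_(i < N) fine (P (X i @^-1` B i)))%:E).

(* A measure of the library has unspecified values off the sigma-algebra, so
   "P(E) >= p" includes that E is an event. *)
Definition prob_ge (R : realType) (d : measure_display) (T : measurableType d)
    (P : probability T R) (E : set T) (p : R) : Prop :=
  measurable E /\ (p%:E <= P E)%E.

Definition hfun (R : realType) (x : R) : R := x ^+ 2 / (ln (2 + x^-1)) ^+ 2.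

(* Inverse of the increasing bijection hfun of ]0, +oo[; 0 where undefined. *)
Definition hinv (R : realType) (y : R) : R :=
  xget 0 [set x : R | 0 < x /\ hfun x = y].

Definition epsN (R : realType) (n : nat) (C c : R) (N : nat) (beta rho : R)
    : R :=
  match n with
  | 0 => 0 (* unused: n >= 1 *)
  | 1 => Num.sqrt (ln (C * beta^-1) / c) * rho * (Num.sqrt N%:R)^-1
  | 2 => hinv (ln (C * beta^-1) / (c * N%:R)) * rho
  | _ => (ln (C * beta^-1) / c) `^ (n%:R^-1) * rho * N%:R `^ (- n%:R^-1)
  end.

(* C and c are constants, for dimension n, of the concentration inequality for
   empirical measures of compactly supported laws. *)
Definition concentration_constants (R : realType) (n : nat) (C c : R) : Prop :=
  forall (d : measure_display) (T : measurableType d) (P : probability T R)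
    (mu : probability 'rV[R]_n R) (N : nat) (X : 'I_N -> {RV P >-> 'rV[R]_n})
    (beta : R),
    (0 < N)%N -> iid X mu -> compactly_supported mu -> 0 < beta < 1 ->
    prob_ge P
      [set w | (wasserstein1 (@edist R n) (empirical R (fun i => X i w)) mu
                <= (epsN n C c N beta (diam (msupport mu) / 2))%:E)%E]
      (1 - beta).

(* Main.v *)
Require Import Defs.
From HB Require Import structures.
From mathcomp Require Import all_boot all_order all_algebra.
From mathcomp Require Import all_classical all_reals all_analysis.
From mathcomp Require Import measurable_realfun lra.

(** Why the theorem holds.

    Pushing a coupling of the empirical law of the parameters and the true
    parameter law forward by [(u, u)], where [u] is [L]-Lipschitz, couples the
    empirical and the true laws of the scalar data and multiplies the transport
    cost by at most [L] ([wasserstein1_cdf_lipschitz]).  Hence one single event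
    about the parameters, that their Wasserstein distance is at most [eps],
    forces all the scalar distances, for all points and times simultaneously, to
    be at most [L * eps]; the concentration inequality gives this event
    probability at least [1 - beta].  Membership of the true CDFs in [CD] is
    deterministic: a Borel probability on R^n is carried by its topological
    support ([supported_on_msupport]), which lies in the max-norm ball of radius
    [rho] around [abar], and a vector of max norm at most [rho] has Euclidean
    norm at most [sqrt n * rho].

    The delicate point is that the event of the theorem, an intersection over
    uncountably many points, is measurable.  It is the preimage, under the
    random samples, of a set of sample configurations that is closed, because
    each single constraint is closed; and closed sets of configurations have
    measurable preimages because R^n is second countable
    ([measurable_closed_preimage]).  A single constraint is closed because moving
    the atoms of an empirical law by at most [e] changes its Wasserstein distance
    to any other law by at most [e] ([wasserstein1_cdf_shift_atoms]).  For this,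
    a coupling is cut into its slices over the atoms, and each slice is
    translated with its atom.  Distinct sample points may produce the same atom
    and then move apart, so the mass over an atom is shared equally between the
    samples that produced it ([measure_weighted_atoms]).  That the first marginal
    of the coupling is the empirical law itself, although only its CDF is known,
    is the uniqueness of the law with a given CDF ([eq_cdf_of]). *)

Set Implicit Arguments.
Unset Strict Implicit.
Unset Printing Implicit Defensive.

Import Order.TTheory GRing.Theory Num.Theory.
Import numFieldNormedType.Exports.

Local Open Scope classical_set_scope.
Local Open Scope ring_scope.

(** * Rational balls and the support of a measure *)

Lemma coord_le_norm (R : realType) (n : nat) (x : 'rV[R]_n) (j : 'I_n) :
  `|x ord0 j| <= `|x|.
Proof.
rewrite [leRHS]/Num.norm/= mx_normrE.
by apply: (@le_bigmax_cond _ _ _ 0 (ord0, j) xpredT (fun ij => `|x ij.1 ij.2|)).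
Qed.

Lemma norm_row_lt (R : realType) (n : nat) (x : 'rV[R]_n) (e : R) : 0 < e ->
  (forall j, `|x ord0 j| < e) -> `|x| < e.
Proof.
move=> e0 xe; rewrite [ltLHS]/Num.norm/= mx_normrE.
by apply/bigmax_ltP; split=> // -[i j] _; rewrite /= ord1; exact: xe.
Qed.

Lemma enorm_le_norm (R : realType) (n : nat) (x : 'rV[R]_n) :
  enorm x <= Num.sqrt n%:R * `|x|.
Proof.
rewrite -[X in _ * X]ger0_norm// -sqrtr_sqr -sqrtrM ?ler0n// ler_wsqrtr//.
rewrite (le_trans (ler_sum _ (fun j _ => _ : _ <= `|x| ^+ 2)))//.
  by move=> j; rewrite -real_normK ?num_real// ler_sqr ?nnegrE// coord_le_norm.
by rewrite sumr_const card_ord -[leLHS]mulr_natl.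
Qed.

Lemma rational_row_near (R : realType) (n : nat) (x : 'rV[R]_n) (e : R) :
  0 < e -> exists q : 'rV[rat]_n, `|map_mx ratr q - x| < e.
Proof.
move=> e0.
have /choice[f fP] : forall j, exists q : rat, `|ratr q - x ord0 j| < e.
  move=> j; have [|q] := @rat_in_itvoo R (x ord0 j - e) (x ord0 j + e).
    by rewrite ltrBlDr -addrA ltrDl addr_gt0.
  by rewrite in_itv/= => qP; exists q; rewrite ltr_distl.
exists (\row_j f j); apply: norm_row_lt => // j.
by rewrite !mxE; exact: fP.
Qed.

(** The pairs of a rational centre and a natural number index a countable base of
    the topology of R^n. *)
Definition rational_ball (R : realType) (n : nat) (p : 'rV[rat]_n * nat) :
  set 'rV[R]_n := ball (map_mx ratr p.1 : 'rV[R]_n) p.2.+1%:R^-1.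
Arguments rational_ball R {n} p.

Lemma rational_ballE (R : realType) (n : nat) (p : 'rV[rat]_n * nat) :
  rational_ball R p = [set x | `|map_mx ratr p.1 - x| < p.2.+1%:R^-1].
Proof. by rewrite /rational_ball mx_norm_ball. Qed.

Lemma rational_ball_open (R : realType) (n : nat) (p : 'rV[rat]_n * nat) :
  open (rational_ball R p).
Proof. exact: ball_open. Qed.

(** The two summands: a rational centre within [1/(k+1)] of a point has its ball
    of radius [1/(k+1)] inside the ball of radius [2/(k+1)] around that point. *)
Lemma rational_radius (R : realType) (e : R) : 0 < e ->
  exists k, k.+1%:R^-1 + k.+1%:R^-1 <= e.
Proof.
move=> e0; exists (Num.truncn (2 / e)).
have := truncnS_gt (2 / e); set k := _.+1 => ek.
rewrite -mulr2n -[leLHS]mulr_natl ler_pdivrMr ?ltr0n//.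
by rewrite mulrC -ler_pdivrMr// ltW.
Qed.

Lemma open_rational_ball (R : realType) (n : nat) (U : set 'rV[R]_n) x :
  open U -> U x -> exists2 p, rational_ball R p x & rational_ball R p `<=` U.
Proof.
rewrite openE => /[apply] /nbhs_ballP[e /= e0]; rewrite mx_norm_ball => xU.
have [k ke] := rational_radius e0.
have k0 : 0 < k.+1%:R^-1 :> R by rewrite invr_gt0.
have [q qx] := rational_row_near x k0.
exists (q, k); rewrite rational_ballE//= => y /= qy.
apply: xU => /=; rewrite (lt_le_trans _ ke)//.
rewrite (_ : x - y = (map_mx ratr q - y) - (map_mx ratr q - x)); last first.
  by rewrite opprB [RHS]addrC subrKA.
by rewrite (le_lt_trans (ler_normB _ _))// ltrD.
Qed.

Lemma open_setC_msupport (R : realType) (n : nat)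
    (mu : set 'rV[R]_n -> \bar R) : open (~` msupport mu).
Proof.
rewrite (_ : ~` _ = \bigcup_(U in [set U | open U /\ ~ (0 < mu U)%E]) U).
  by apply: bigcup_open => U [].
apply/seteqP; split=> [x /existsNP[U /not_implyP[oU /not_implyP[Ux muU]]]|].
  by exists U.
by move=> x [U [oU muU] Ux] /(_ U oU Ux).
Qed.

(** The complement of the support is covered by null open sets, and second
    countability reduces this cover to the countably many null rational balls. *)
Lemma supported_on_msupport (R : realType) (n : nat)
  (mu : {measure set 'rV[R]_n -> \bar R}) : supported_on mu (msupport mu).
Proof.
have mB p : measurable (rational_ball R p : set 'rV[R]_n).
  by apply: sub_sigma_algebra; exact: rational_ball_open.
(* Balls that are not null are replaced by the empty set, and so are the natural
   numbers that encode no ball. *)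
pose null (p : 'rV[rat]_n * nat) := mu (rational_ball R p) = 0%E.
pose F i : set 'rV[R]_n :=
  if unpickle i is Some p then [set x | rational_ball R p x /\ null p] else set0.
rewrite /supported_on; have -> : ~` msupport mu = \bigcup_i F i.
  apply/seteqP; split=> [x /existsNP[U /not_implyP[oU]]|x [i _]].
    move=> /not_implyP[Ux /negP]; rewrite -leNgt => muU.
    have [p px pU] := open_rational_ball oU Ux.
    exists (pickle p) => //; rewrite /F pickleK; split=> //.
    apply/eqP; rewrite eq_le measure_ge0 andbT (le_trans _ muU)//.
    by apply: le_measure; rewrite ?inE//; exact: sub_sigma_algebra.
  rewrite /F; case: unpickle => // p [px p0].
  by move=> /(_ _ (@rational_ball_open R n p) px); rewrite [mu _]p0 ltxx.
have FE i : measurable (F i) /\ mu (F i) = 0%E.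
  rewrite /F; case: unpickle => [p|]; last by rewrite measure0.
  have [p0|p0] := pselect (null p).
    suff -> : [set x | rational_ball R p x /\ null p] = rational_ball R p by [].
    by apply/seteqP; split=> x //= -[].
  rewrite (_ : mkset _ = set0) ?measure0//.
  by apply/seteqP; split=> x //= -[].
apply: measure_negligible.
  by apply: bigcupT_measurable => i; exact: (FE i).1.
by apply: negligible_bigcup => i; exists (F i); have [] := FE i; split.
Qed.

(** * Measurability *)

(** The hypothesis on [S] says that [S] is closed for the uniform distance on
    configurations of [N] points.  The complement of [S] is then a countable union
    of products of rational balls, and the preimage of such a product is a finite
    intersection of events. *)
Lemma measurable_closed_preimage (R : realType) (n N : nat)
    (disp : measure_display) (T : measurableType disp)
    (a : 'I_N -> T -> 'rV[R]_n) (S : set ('I_N -> 'rV[R]_n)) :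
  (forall i, measurable_fun setT (a i)) ->
  (forall b, (forall e, 0 < e ->
     exists2 b', S b' & forall i, `|b i - b' i| < e) -> S b) ->
  measurable [set w | S (fun i => a i w)].
Proof.
move=> ma Sclosed; rewrite -[X in measurable X]setCK; apply: measurableC.
pose box (p : {ffun 'I_N -> 'rV[rat]_n * nat}) : set ('I_N -> 'rV[R]_n) :=
  [set b | forall i, rational_ball R (p i) (b i)].
pose F p : set T := [set w | box p (fun i => a i w) /\ box p `<=` ~` S].
have -> : ~` [set w | S (fun i => a i w)] = \bigcup_p F p.
  apply/seteqP; split=> [w /= nSw|w [p _ [pw pS]]]; last exact: pS.
  have [e e0 eS] : exists2 e, 0 < e & forall b',
      (forall i, `|a i w - b' i| < e) -> ~ S b'.
    apply: contra_notP nSw => noe; apply: Sclosed => e e0.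
    apply: contra_notP noe => nob'; exists e => // b' b'e Sb'.
    by apply: nob'; exists b'.
  (* A product of rational balls around the samples, inside the uniform ball of
     radius e, avoids S. *)
  have /choice[f fP] : forall i, exists p : 'rV[rat]_n * nat,
      rational_ball R p (a i w) /\ rational_ball R p `<=` ball (a i w) e.
    move=> i; have [p pw pe] :=
      open_rational_ball (ball_open (a i w) e) (ballxx _ e0).
    by exists p.
  exists (finfun f) => //; split=> [i|b fb]; first by rewrite ffunE; exact: (fP i).1.
  apply: eS => i; have := fb i; rewrite ffunE => /(fP i).2.
  by rewrite mx_norm_ball.
apply: countable_bigcupT_measurable => // p.
have [pS|pS] := pselect (box p `<=` ~` S); last first.
  rewrite (_ : F p = set0)//.
  by apply/seteqP; split=> w // -[].
rewrite (_ : F p = \bigcap_(i in setT) (a i @^-1` rational_ball R (p i))).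
  apply: fin_bigcap_measurable => // i _.
  rewrite -[X in measurable X]setTI; apply: ma => //.
  by apply: sub_sigma_algebra; exact: ball_open.
by apply/seteqP; split=> w; [move=> [pw _] i _; exact: pw|
  move=> pw; split=> // i; exact: pw].
Qed.

Lemma lipschitz_measurable (R : realType) (n : nat) (u : 'rV[R]_n -> R) (K : R) :
  (forall a a', `|u a - u a'| <= K * `|a - a'|) -> measurable_fun setT u.
Proof.
move=> uK; apply: (measurability _ (RGenOInfty.measurableE R)) => //.
move=> _ [_ [x ->] <-]; rewrite setTI; apply: sub_sigma_algebra.
suff : open (u @^-1` `]x, +oo[) by [].
rewrite openE => a /=; rewrite in_itv/= andbT => xu.
(* K may vanish or be negative, whence the denominator. *)
pose e := (u a - x) / (`|K| + 1).
have K0 : 0 < `|K| + 1 by rewrite ltr_wpDl.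
apply/nbhs_ballP; exists e => /=; first by rewrite divr_gt0// subr_gt0.
rewrite mx_norm_ball => b /= abe; rewrite /= in_itv/= andbT.
have : `|u a - u b| < u a - x.
  rewrite (le_lt_trans (uK _ _))//.
  rewrite (@le_lt_trans _ _ (`|a - b| * (`|K| + 1)))//; last first.
    by rewrite -ltr_pdivlMr.
  by rewrite mulrC ler_wpM2l// (le_trans (ler_norm _))// lerDl.
by rewrite ltr_distlC => /andP[]; lra.
Qed.

Lemma measurable_coord (R : realType) (n : nat) (j : 'I_n) :
  measurable_fun setT (fun a : 'rV[R]_n => a ord0 j).
Proof.
apply: (@lipschitz_measurable _ _ _ 1) => a a'; rewrite mul1r.
by have := coord_le_norm (a - a') j; rewrite !mxE.
Qed.

Lemma measurable_edist (R : realType) (n : nat) :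
  measurable_fun setT (fun z : 'rV[R]_n * 'rV[R]_n => Defs.edist z.1 z.2).
Proof.
rewrite /Defs.edist /enorm; apply: measurableT_comp.
  exact: (continuous_measurable_fun (@sqrt_continuous R)).
apply: measurable_sum => j; apply: measurable_funX.
rewrite (_ : (fun _ => _) =
    (fun z : 'rV[R]_n * 'rV[R]_n => z.1 ord0 j - z.2 ord0 j)).
  by apply: measurable_funB;
    apply: (measurableT_comp (@measurable_coord R n j)).
by apply/funext => z; rewrite !mxE.
Qed.

Lemma measurable_rdist (R : realType) :
  measurable_fun setT (fun z : R * R => rdist z.1 z.2).
Proof. by apply: measurableT_comp => //; exact: measurable_funB. Qed.

(** * Image measures, probabilities and CDFs *)

Definition mfun_of (d d' : measure_display) (T : measurableType d)
    (T' : measurableType d') (f : T -> T') (mf : measurable_fun setT f) :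
    {mfun T >-> T'} := HB.pack f (isMeasurableFun.Build _ _ _ _ _ mf).

Lemma pushforward_measure (R : realType) (d d' : measure_display)
    (T : measurableType d) (T' : measurableType d')
    (m : {measure set T -> \bar R}) (f : T -> T') : measurable_fun setT f ->
  exists m' : {measure set T' -> \bar R}, m' = pushforward m f :> (set T' -> \bar R).
Proof.
by move=> mf; unshelve eexists (pushforward m f); first exact: mf.
Qed.

Lemma mass1_probability (R : realType) (d : measure_display)
    (T : measurableType d) (m : {measure set T -> \bar R}) :
  m setT = 1%E -> exists P : probability T R, P = m :> (set T -> \bar R).
Proof.
move=> m1; exists (mnormalize m (dirac point : probability T R)).
apply/funext => A /=; rewrite /mnormalize m1.
rewrite (_ : (_ || _) = false); last by rewrite eqe oner_eq0.
by rewrite /= invr1 mule1.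
Qed.

Lemma empirical_measure (R : realType) (d : measure_display)
    (T : measurableType d) (N : nat) (x : 'I_N -> T) :
  exists m : {measure set T -> \bar R}, forall A, m A = empirical R x A.
Proof.
case: N x => [|N] x.
  by exists mzero => A; rewrite /empirical big_ord0 mule0.
have N0 : 0 <= N.+1%:R^-1 :> R by [].
pose dx k : {measure set T -> \bar R} := \d_(x (inord k)).
exists (mscale (NngNum N0) (msum dx N.+1)) => A.
rewrite /mscale /empirical/= /msum; congr (_ * _)%E.
by apply: eq_bigr => i _; rewrite /dx inord_val.
Qed.

(** The half-lines [`]-oo, y]] are stable under intersection and generate the
    Borel sets of R. *)
Lemma eq_cdf_of (R : realType) (mu nu : {measure set R -> \bar R}) :
  (mu setT < +oo)%E -> cdf_of mu = cdf_of nu ->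
  forall A, measurable A -> mu A = nu A.
Proof.
move=> muoo munu A mA; pose G := [set B | exists y : R, B = `]-oo, y]%classic].
apply: (measure_unique G (fun k => `]-oo, k%:R]%classic)) => //.
- rewrite [LHS](RGenOInfty.measurableE R).
  have mG B : G.-sigma.-measurable B = <<s G >> B by [].
  rewrite eqEsubset; split; apply: smallest_sub;
    try exact: smallest_sigma_algebra.
    move=> _ [y ->]; rewrite -mG -setCitvl; apply: measurableC.
    by apply: sub_sigma_algebra; exists y.
  move=> _ [y ->].
  have : (@RGenOInfty.G R).-sigma.-measurable (~` `]y, +oo[%classic).
    by apply: measurableC; apply: sub_sigma_algebra; exists y.
  by rewrite setCitvr.
- by move=> _ _ [y ->] [z ->]; exists (Num.min y z); apply/seteqP;
    split=> t /=; rewrite !in_itv/= le_min; [move=> [-> ->]|move=> /andP[]].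
- by move=> k; exists k%:R.
- rewrite -subTset => y _; exists (Num.truncn `|y|).+1 => //=.
  by rewrite in_itv/= (le_trans (ler_norm y))// ltW// truncnS_gt.
- by move=> _ [y ->]; have /(congr1 (fun F => F y)) := munu.
- by move=> k; rewrite (le_lt_trans _ muoo)// le_measure// inE.
Qed.

(** * Wasserstein distance between CDFs as an infimum over joint laws *)

(** With the converse [wasserstein1_cdf_lt], this replaces the two nested infima
    that define the distance by one infimum over the joint laws [pi], whose
    marginals need only be known through their CDFs. *)
Lemma wasserstein1_cdf_le (R : realType) (pi : probability (R * R)%type R)
    (F G : R -> \bar R) (r : \bar R) :
  cdf_of (pushforward pi fst) = F -> cdf_of (pushforward pi snd) = G ->
  (\int[pi]_z (rdist z.1 z.2)%:E <= r)%E -> (wasserstein1_cdf F G <= r)%E.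
Proof.
move=> <- <-; apply: le_trans.
pose mu : probability R R := distribution pi (mfun_of measurable_fst).
pose nu : probability R R := distribution pi (mfun_of measurable_snd).
apply: (@le_trans _ _ (wasserstein1 (@rdist R) mu nu)).
  by apply: ereal_inf_lbound; exists mu, nu.
apply: ereal_inf_lbound; exists pi => // A mA.
rewrite /mu /nu /distribution /pushforward; split; congr (pi _);
  by apply/seteqP; split=> -[x y] /=; tauto.
Qed.

Lemma wasserstein1_cdf_lt (R : realType) (F G : R -> \bar R) (r : \bar R) :
  (wasserstein1_cdf F G < r)%E ->
  exists pi : probability (R * R)%type R,
    [/\ cdf_of (pushforward pi fst) = F, cdf_of (pushforward pi snd) = G &
      (\int[pi]_z (rdist z.1 z.2)%:E < r)%E].
Proof.
move=> /ereal_inf_lt[_ [mu [nu [<- <- ->]]]].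
move=> /ereal_inf_lt[_ [pi pimunu <-] pir]; exists pi; split=> //.
  apply/funext => y; rewrite /cdf_of -(pimunu _ (measurable_itv _)).1.
  by rewrite /pushforward; congr (pi _); apply/seteqP; split=> -[? ?] /=; tauto.
apply/funext => y; rewrite /cdf_of -(pimunu _ (measurable_itv _)).2.
by rewrite /pushforward; congr (pi _); apply/seteqP; split=> -[? ?] /=; tauto.
Qed.

(** The image by [(u, u)] of a coupling of cost [c] has the CDFs of the scalar
    laws as marginals and cost at most [L * c]. *)
Lemma wasserstein1_cdf_lipschitz (R : realType) (n N : nat)
    (u : 'rV[R]_n -> R) (L r : R) (mu : probability 'rV[R]_n R)
    (x : 'I_N -> 'rV[R]_n) : 0 <= L ->
  (forall a a', `|u a - u a'| <= L * enorm (a - a')) -> measurable_fun setT u ->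
  (wasserstein1 (@Defs.edist R n) (empirical R x) mu <= r%:E)%E ->
  (wasserstein1_cdf (cdf_of (empirical R (u \o x))) (cdf_of (pushforward mu u))
    <= (L * r)%:E)%E.
Proof.
move=> L0 uL mu_ Wr; apply/lee_addgt0Pr => e e0.
(* L may vanish, whence the denominator of the slack on the parameter side. *)
pose d := e / (L + 1); have L10 : 0 < L + 1 by rewrite ltr_wpDl.
have d0 : 0 < d by rewrite divr_gt0.
have /ereal_inf_lt[_ [pi pixmu <-] pir] :
    (wasserstein1 (@Defs.edist R n) (empirical R x) mu < (r + d)%:E)%E.
  by rewrite (le_lt_trans Wr)// lte_fin ltrDl.
pose uu (z : 'rV[R]_n * 'rV[R]_n) := (u z.1, u z.2).
have muu : measurable_fun setT uu.
  apply: measurable_fun_pair; first exact: (measurableT_comp mu_ measurable_fst).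
  exact: (measurableT_comp mu_ measurable_snd).
have mpre y : measurable (u @^-1` `]-oo, y]).
  by rewrite -[X in measurable X]setTI; exact: mu_.
apply: (@wasserstein1_cdf_le _ (distribution pi (mfun_of muu) : probability _ _)).
- apply/funext => y; rewrite /cdf_of /distribution /pushforward/=.
  have := (pixmu _ (mpre y)).1; rewrite /empirical => <-.
  by congr (pi _); apply/seteqP; split=> -[? ?] /=; tauto.
- apply/funext => y; rewrite /cdf_of /distribution /pushforward/=.
  rewrite -(pixmu _ (mpre y)).2.
  by congr (pi _); apply/seteqP; split=> -[? ?] /=; tauto.
- have mdist : measurable_fun setT (fun z : R * R => (rdist z.1 z.2)%:E).
    by apply/measurable_EFinP; exact: measurable_rdist.
  have dist0 : {in setT, forall z : R * R, (0 <= (rdist z.1 z.2)%:E)%E}.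
    by move=> z _; rewrite lee_fin normr_ge0.
  rewrite (ge0_integral_pushforward muu pi measurableT mdist dist0)/=.
  rewrite preimage_setT (@le_trans _ _ (L%:E * (r + d)%:E)%E)//; last first.
    rewrite lee_fin mulrDr lerD2l// /d mulrCA ger_pMr// ler_pdivrMr//.
    by rewrite mul1r lerDl.
  apply: (@le_trans _ _ (\int[pi]_z (L%:E * (Defs.edist z.1 z.2)%:E))%E).
    apply: ge0_le_integral => //.
    - by move=> z _; rewrite lee_fin normr_ge0.
    - apply/measurable_EFinP.
      exact: (measurableT_comp (@measurable_rdist R) muu).
    - by apply: measurable_funeM; apply/measurable_EFinP; exact: measurable_edist.
    - by move=> z _; rewrite lee_fin; exact: uL.
  rewrite ge0_integralZl_EFin//=.
  - by rewrite lee_wpmul2l ?lee_fin// ltW.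
  - by move=> z _; rewrite lee_fin sqrtr_ge0.
  - by apply/measurable_EFinP; exact: measurable_edist.
Qed.

(** * Moving the atoms of an empirical law *)

Lemma sum_over_multiplicity (R : numFieldType) (T : eqType) (s : seq T)
    (f : T -> R) :
  \sum_(y <- s) (count_mem y s)%:R^-1 * f y = \sum_(y <- undup s) f y.
Proof.
rewrite -big_undup_iterop_count/= big_seq [RHS]big_seq.
apply: eq_bigr => y; rewrite mem_undup => ys.
have c0 : (count_mem y s)%:R != 0 :> R.
  by rewrite pnatr_eq0 -lt0n -has_count has_pred1.
by rewrite -[LHS]/(_ *+ _) -[LHS]mulr_natl mulrA mulfV// mul1r.
Qed.

Lemma measurable_seq (R : realType) (r : seq R) : measurable [set` r].
Proof.
apply: countable_measurable; last exact/finite_set_countable/finite_seq.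
by move=> y; exact: measurable_set1.
Qed.

Section shift_atoms.
Variables (R : realType) (N : nat) (pi : probability (R * R)%type R).
Variable v : 'I_N -> R.
Hypothesis pi1 : cdf_of (pushforward pi fst) = cdf_of (empirical R v).

Let s := [seq v i | i <- enum 'I_N].
Let slice (y : R) : set (R * R) := fst @^-1` [set y].

Lemma first_marginal_empirical (A : set R) : measurable A ->
  pi (fst @^-1` A) = empirical R v A.
Proof.
have [m mE] := @empirical_measure R _ _ N v.
move=> mA; rewrite -mE.
pose mu : probability R R := distribution pi (mfun_of measurable_fst).
apply: (@eq_cdf_of _ mu) => //.
  by rewrite (le_lt_trans (probability_le1 mu measurableT))// ltry.
by rewrite [LHS]pi1; apply/funext => y; rewrite /cdf_of mE.
Qed.

Lemma measurable_slice (y : R) : measurable (slice y).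
Proof. by rewrite -[slice y]setTI; exact: measurable_fst. Qed.

Lemma slice_measure (y : R) :
  pi (slice y) = (N%:R^-1 * (count_mem y s)%:R)%:E.
Proof.
rewrite first_marginal_empirical// /empirical EFinM; congr (_ * _)%E.
rewrite -sum1_count natr_sum -sumEFin big_map big_enum_cond/= [RHS]big_mkcond/=.
by apply: eq_bigr => i _; rewrite diracE in_set1; case: (v i == y).
Qed.

Lemma measure_atoms (A : set (R * R)) : measurable A ->
  pi A = (\sum_(y <- undup s) pi (A `&` slice y))%E.
Proof.
move=> mA; pose B : set (R * R) := fst @^-1` [set` s].
have ms := @measurable_seq R s.
have mB : measurable B by rewrite -[B]setTI; exact: measurable_fst.
have B1 : pi (~` B) = 0%E.
  rewrite /B preimage_setC first_marginal_empirical; last exact: measurableC.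
  rewrite /empirical big1 ?mule0// => i _; rewrite diracE memNset//= => /negP[].
  by rewrite map_f ?mem_enum.
transitivity (pi (A `&` B)).
  rewrite (measureDI _ mA mB) [X in (X + _)%E](_ : _ = 0%E) ?add0e//.
  apply: (subset_measure0 _ _ _ B1) => //; first exact: measurableD.
  exact: measurableC.
have -> : B = fst @^-1` [set` undup s].
  by apply/seteqP; split=> z /=; rewrite mem_undup.
elim: (undup s) (undup_uniq s) => [_|y r IH /= /andP[yr ur]].
  rewrite big_nil (_ : _ `&` _ = set0) ?measure0//.
  by apply/seteqP; split=> // z [].
have mr := @measurable_seq R r.
rewrite big_cons -IH// -measureU.
- congr (pi _); apply/seteqP; split=> z /=; rewrite inE.
    by move=> [Az /orP[/eqP|]]; tauto.
  by move=> [[Az ->]|[Az ->]]; rewrite ?eqxx ?orbT.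
- by apply: measurableI => //; exact: measurable_slice.
- apply: measurableI => //; rewrite -[_ @^-1` _]setTI; exact: measurable_fst.
- apply/seteqP; split=> // z [[_ zy] [_ /=]].
  by rewrite zy (negPf yr).
Qed.

(** An atom hit by [m] samples occurs [m] times in the sum over the samples, each
    time with weight [1/m]. *)
Lemma measure_weighted_atoms (A : set (R * R)) : measurable A ->
  pi A = (\sum_(i < N)
    ((count_mem (v i) s)%:R^-1)%:E * pi (A `&` slice (v i)))%E.
Proof.
move=> mA; rewrite measure_atoms//.
have fin y : pi (A `&` slice y) = (fine (pi (A `&` slice y)))%:E.
  rewrite fineK// fin_num_measure//.
  by apply: measurableI => //; exact: measurable_slice.
rewrite (eq_bigr _ (fun y _ => fin y)) sumEFin -sum_over_multiplicity.
rewrite -sumEFin big_map big_enum/=; apply: eq_bigr => i _.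
by rewrite EFinM -fin.
Qed.

End shift_atoms.

(** Take a nearly optimal joint law and translate, for each sample [i], its share
    of the slice over [v i] by [v' i - v i] in the first coordinate.  The first
    marginal becomes the empirical law of [v'], the second one is unchanged, and
    each unit of mass pays at most [e] more. *)
Lemma wasserstein1_cdf_shift_atoms (R : realType) (N : nat) (v v' : 'I_N -> R)
    (G : R -> \bar R) (r e : R) : (0 < N)%N -> 0 <= e ->
  (forall i, `|v i - v' i| <= e) ->
  (wasserstein1_cdf (cdf_of (empirical R v)) G <= r%:E)%E ->
  (wasserstein1_cdf (cdf_of (empirical R v')) G <= (r + e)%:E)%E.
Proof.
case: N v v' => // N v v' _ e0 vv' Wr; apply/lee_addgt0Pr => d d0.
have /wasserstein1_cdf_lt[pi [pi1 pi2 pir]] :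
    (wasserstein1_cdf (cdf_of (empirical R v)) G < (r + d)%:E)%E.
  by rewrite (le_lt_trans Wr)// lte_fin ltrDl.
pose s := [seq v i | i <- enum 'I_N.+1].
pose slice (i : 'I_N.+1) : set (R * R) := fst @^-1` [set v i].
have mslice i : measurable (slice i) by exact: measurable_slice.
have w0 (i : 'I_N.+1) : 0 <= (count_mem (v i) s)%:R^-1 :> R by [].
pose piece k : {measure set (R * R) -> \bar R} :=
  mscale (NngNum (w0 (inord k))) (mrestr pi (mslice (inord k))).
pose move k (z : R * R) := (z.1 + (v' (inord k) - v (inord k)), z.2).
have mmove k : measurable_fun setT (move k).
  by apply: measurable_fun_pair => //; exact: measurable_funD.
have /choice[moved movedE] : forall k,
    exists m : {measure set (R * R) -> \bar R},
    m = pushforward (piece k) (move k) :> (set (R * R) -> \bar R).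
  by move=> k; exact: pushforward_measure.
pose pi' : {measure set (R * R) -> \bar R} := msum moved N.+1.
have pieceE (i : 'I_N.+1) A :
    piece i A = ((count_mem (v i) s)%:R^-1%:E * pi (A `&` slice i))%E.
  by rewrite /piece /mscale/= /mrestr inord_val.
have piE A : measurable A -> pi A = msum piece N.+1 A.
  move=> mA; rewrite (measure_weighted_atoms pi1 mA) /msum.
  by apply: eq_bigr => i _; rewrite pieceE.
have pi'2 A : measurable A -> pi' (snd @^-1` A) = pi (snd @^-1` A).
  move=> mA; rewrite piE; last first.
    by rewrite -[_ @^-1` _]setTI; exact: measurable_snd.
  by rewrite /pi'/= /msum; apply: eq_bigr => k _; rewrite movedE.
have pi'T : pi' setT = 1%E.
  by have := pi'2 _ measurableT; rewrite preimage_setT probability_setT.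
have pi'1 A : measurable A -> pi' (fst @^-1` A) = empirical R v' A.
  move=> mA; rewrite /pi'/= /msum /empirical ge0_sume_distrr//.
  apply: eq_bigr => i _.
  rewrite movedE /pushforward pieceE.
  (* The translation sends the whole slice over v i to the line over v' i. *)
  have [Av'|Av'] := pselect (A (v' i)); last first.
    rewrite diracE memNset// mule0 (_ : _ `&` _ = set0) ?measure0 ?mule0//.
    apply/seteqP; split=> // -[x y] [/=]; rewrite /move inord_val/= => + xv.
    by rewrite [x]xv addrC subrK.
  rewrite diracE mem_set//= mule1 (_ : _ `&` _ = slice i); last first.
    apply/seteqP; split=> [z []//|z zi]; split=> //.
    by rewrite /move/= inord_val [z.1]zi addrC subrK.
  rewrite [pi _](slice_measure pi1) -EFinM mulrCA mulVf ?mulr1//.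
  by rewrite pnatr_eq0 -lt0n -has_count has_pred1 map_f ?mem_enum.
have [pi'P pi'PE] := mass1_probability pi'T.
have mdist : measurable_fun setT (fun z : R * R => (rdist z.1 z.2)%:E).
  by apply/measurable_EFinP; exact: measurable_rdist.
have dist0 (z : R * R) : (0 <= (rdist z.1 z.2)%:E)%E.
  by rewrite lee_fin normr_ge0.
apply: (@wasserstein1_cdf_le _ pi'P).
- apply/funext => y; rewrite /cdf_of /pushforward pi'PE.
  by rewrite (pi'1 `]-oo, y]%classic).
- rewrite -pi2; apply/funext => y; rewrite /cdf_of /pushforward pi'PE.
  by rewrite (pi'2 `]-oo, y]%classic).
rewrite pi'PE ge0_integral_measure_sum//.
apply: (@le_trans _ _
    (\sum_(k < N.+1) \int[piece k]_z ((rdist z.1 z.2)%:E + e%:E)))%E.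
  apply: lee_sum => k _.
  rewrite movedE (ge0_integral_pushforward (mmove k))//.
  rewrite preimage_setT; apply: ge0_le_integral => //.
  - by move=> z _; exact: dist0.
  - exact: (measurableT_comp mdist (mmove k)).
  - exact: emeasurable_funD.
  - move=> z _; rewrite /= -EFinD lee_fin /rdist /move/= inord_val.
    rewrite addrAC (le_trans (ler_normD _ _))// lerD2l distrC; exact: vv'.
rewrite -ge0_integral_measure_sum//; last 2 first.
- by move=> z _; rewrite adde_ge0// lee_fin.
- exact: emeasurable_funD.
rewrite (eq_measure_integral pi); last by move=> A mA _; apply/esym/piE.
rewrite ge0_integralD//= integral_cst//.
rewrite [X in (_ * X)%E](_ : _ = 1%E) ?mule1; last exact: probability_setT.
by rewrite -EFinD [(r + e + d)%R]addrAC [leRHS]EFinD; apply: leeD2r; exact: ltW.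
Qed.

(** * Ambiguity sets of Lipschitz data *)

Section lipschitz_parameterization.
Variables (R : realType) (n N : nat) (Ptrue : probability 'rV[R]_n R).
Variables (u : 'rV[R]_n -> R) (L rho : R) (abar : 'rV[R]_n).
Hypothesis L_ge0 : 0 <= L.
Hypothesis u_lip : forall a a', `|u a - u a'| <= L * enorm (a - a').

Lemma enorm_lipschitz_measurable : measurable_fun setT u.
Proof.
apply: (@lipschitz_measurable _ _ _ (L * Num.sqrt n%:R)) => a a'.
by rewrite -mulrA (le_trans (u_lip _ _))// ler_wpM2l// enorm_le_norm.
Qed.

Lemma pushforward_CD : (forall v, msupport Ptrue v -> `|v - abar| <= rho) ->
  CD `[u abar - Num.sqrt n%:R * L * rho, u abar + Num.sqrt n%:R * L * rho]
    (cdf_of (pushforward Ptrue u)).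
Proof.
move=> hrho; exists _, _, Ptrue, (mfun_of enorm_lipschitz_measurable).
split=> //; apply: (subset_measure0 _ _ _ (supported_on_msupport Ptrue)).
- rewrite -[X in measurable X]setTI; apply: enorm_lipschitz_measurable => //.
  exact: measurableC.
- by apply: sub_sigma_algebra; exact: open_setC_msupport.
move=> v /= + /hrho vrho; apply; rewrite in_itv/= -ler_distl.
rewrite (le_trans (u_lip _ _))// [_ * L]mulrC -mulrA ler_wpM2l//.
by rewrite (le_trans (enorm_le_norm _))// ler_wpM2l// sqrtr_ge0.
Qed.

Lemma ambiguity_lipschitz (x : 'I_N -> 'rV[R]_n) (r : R) :
  (forall v, msupport Ptrue v -> `|v - abar| <= rho) ->
  (wasserstein1 (@Defs.edist R n) (empirical R x) Ptrue <= r%:E)%E ->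
  ambiguity `[u abar - Num.sqrt n%:R * L * rho, u abar + Num.sqrt n%:R * L * rho]
    (cdf_of (empirical R (u \o x))) (L * r) (cdf_of (pushforward Ptrue u)).
Proof.
move=> hrho Wr; split; first exact: pushforward_CD.
exact: (wasserstein1_cdf_lipschitz L_ge0 u_lip enorm_lipschitz_measurable).
Qed.

(** In terms of the samples the constraint is closed, so that, like its
    intersections, it defines an event: samples within [e] of each other give
    scalar data within [L * sqrt n * e] of each other. *)
Lemma ambiguity_closed (I : set R) (r : R) (F : R -> \bar R)
    (x : 'I_N -> 'rV[R]_n) : (0 < N)%N ->
  (forall e, 0 < e -> exists2 x',
     ambiguity I (cdf_of (empirical R (u \o x'))) r F &
     forall i, `|x i - x' i| < e) ->
  ambiguity I (cdf_of (empirical R (u \o x))) r F.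
Proof.
move=> N0 xlim; split; first by have [x' []] := xlim 1 ltr01.
apply/lee_addgt0Pr => e e0.
(* A Lipschitz constant of u for the max norm. *)
pose K := L * Num.sqrt n%:R; have K0 : 0 <= K by rewrite mulr_ge0 ?sqrtr_ge0.
have K10 : 0 < K + 1 by rewrite ltr_wpDl.
have [x' [_ Fx'] xx'] := xlim _ (divr_gt0 e0 K10).
apply: (wasserstein1_cdf_shift_atoms N0 (ltW e0) _ Fx') => i /=.
rewrite (le_trans (u_lip _ _))//.
apply: (@le_trans _ _ (K * `|x' i - x i|)).
  by rewrite -mulrA ler_wpM2l// enorm_le_norm.
rewrite distrC (le_trans (ler_wpM2l K0 (ltW (xx' i))))//.
by rewrite mulrCA ger_pMr// ler_pdivrMr// mul1r lerDl.
Qed.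

End lipschitz_parameterization.

(** * The confidence event *)

Theorem proposition4p3 (R : realType) (n d N : nat)
    (n_gt0 : (0 < n)%N) (N_gt0 : (0 < N)%N)
    (C c : R) (C_gt0 : 0 < C) (c_gt0 : 0 < c)
    (hCc : concentration_constants n C c)
    (Omega Gamma : set 'rV[R]_d)
    (hGamma : Gamma `<=` closure Omega `\` interior Omega)
    (L0 : 'rV[R]_d -> R) (Lb : 'rV[R]_d -> R -> R)
    (L0_ge0 : forall x, Omega x -> 0 <= L0 x)
    (Lb_ge0 : forall x (t : R), Gamma x -> 0 <= t -> 0 <= Lb x t)
    (L0_cont : {within Omega, continuous L0})
    (Lb_cont : {within [set z : 'rV[R]_d * R | Gamma z.1 /\ 0 <= z.2],
                  continuous (fun z : 'rV[R]_d * R => Lb z.1 z.2)})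
    (u0 : 'rV[R]_d -> 'rV[R]_n -> R) (ub : 'rV[R]_d -> R -> 'rV[R]_n -> R)
    (u0_lip : forall x, Omega x -> forall a a' : 'rV[R]_n,
       `|u0 x a - u0 x a'| <= L0 x * enorm (a - a'))
    (ub_lip : forall x (t : R), Gamma x -> 0 <= t -> forall a a' : 'rV[R]_n,
       `|ub x t a - ub x t a'| <= Lb x t * enorm (a - a'))
    (Ptrue : probability 'rV[R]_n R) (hPtrue : compactly_supported Ptrue)
    (disp : measure_display) (T : measurableType disp) (P : probability T R)
    (a : 'I_N -> {RV P >-> 'rV[R]_n}) (ha : iid a Ptrue)
    (rho : R) (hrho : rho = diam (msupport Ptrue) / 2)
    (abar : 'rV[R]_n)
    (habar : forall v, msupport Ptrue v -> `|v - abar| <= rho)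
    (beta : R) (hbeta : 0 < beta < 1) :
  let eps := epsN n C c N beta rho in
  let F0 x := cdf_of (pushforward Ptrue (u0 x)) in
  let Fb x t := cdf_of (pushforward Ptrue (ub x t)) in
  let F0hat x w := cdf_of (empirical R (fun i => u0 x (a i w))) in
  let Fbhat x t w := cdf_of (empirical R (fun i => ub x t (a i w))) in
  let alpha0 x := u0 x abar - Num.sqrt n%:R * L0 x * rho in
  let gamma0 x := u0 x abar + Num.sqrt n%:R * L0 x * rho in
  let alphab x t := ub x t abar - Num.sqrt n%:R * Lb x t * rho in
  let gammab x t := ub x t abar + Num.sqrt n%:R * Lb x t * rho in
  let P0 x w := ambiguity `[alpha0 x, gamma0 x] (F0hat x w) (L0 x * eps) in
  let Pb x t w :=
    ambiguity `[alphab x t, gammab x t] (Fbhat x t w) (Lb x t * eps) in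
  prob_ge P
    ([set w | forall x, Omega x -> P0 x w (F0 x)] `&`
     [set w | forall x (t : R), Gamma x -> 0 <= t -> Pb x t w (Fb x t)])
    (1 - beta).
Proof.
move=> eps F0 Fb F0hat Fbhat alpha0 gamma0 alphab gammab P0 Pb.
have [mW] := hCc _ _ _ _ _ _ _ N_gt0 ha hPtrue hbeta.
rewrite -hrho -/eps in mW * => mass.
set W := (X in P X) in mass; set E := _ `&` _.
pose S : set ('I_N -> 'rV[R]_n) := [set b : 'I_N -> 'rV[R]_n |
  (forall x, Omega x -> ambiguity `[alpha0 x, gamma0 x]
     (cdf_of (empirical R (u0 x \o b))) (L0 x * eps) (F0 x)) /\
  (forall x t, Gamma x -> 0 <= t -> ambiguity `[alphab x t, gammab x t]
     (cdf_of (empirical R (ub x t \o b))) (Lb x t * eps) (Fb x t))].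
have mE : measurable E.
  apply: (@measurable_closed_preimage _ _ _ _ _ (fun i => a i) S) => //.
  move=> b blim; split=> [x Ox|x t Gx t0].
    apply: (ambiguity_closed (L0_ge0 x Ox) (u0_lip x Ox) N_gt0) => e e0.
    by have [b' [Sb' _] bb'] := blim e e0; exists b' => //; exact: Sb'.
  apply: (ambiguity_closed (Lb_ge0 x t Gx t0) (ub_lip x t Gx t0) N_gt0) => e e0.
  by have [b' [_ Sb'] bb'] := blim e e0; exists b' => //; exact: Sb'.
split=> //; apply: (le_trans mass); apply: le_measure; rewrite ?inE//.
move=> w Ww; split=> [x Ox|x t Gx t0].
  exact: (ambiguity_lipschitz (L0_ge0 x Ox) (u0_lip x Ox) habar Ww).
exact: (ambiguity_lipschitz (Lb_ge0 x t Gx t0) (ub_lip x t Gx t0) habar Ww).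
Qed.
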